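(* Let $P_2=ENEN$ and $P_4=ENNE$, and let $$F_{2,4}(x_2,x_4,t)=1+\sum_{n\ge 1}t^n\sum_{L\in\mathcal{L}_n}x_2^{P_2\text{-mch}(L)}x_4^{P_4\text{-mch}(L)}.$$ Then $$F_{2,4}(x_2,x_4,t)=\frac{(x_2-2)\left(-1+\sqrt{1-4t}\right)+2(x_2-1)t}{x_4\left(-1+\sqrt{1-4t}\right)+\left(2+x_2\left(-1+\sqrt{1-4t}\right)+3x_4-x_4\sqrt{1-4t}\right)t}.$$
   Context: $\mathcal{L}_n$ is the set of lattice paths from $(0,0)$ to $(n,n)$ consisting of unit north steps $N$ and unit east steps $E$, equivalently words with $n$ letters $E$ and $n$ letters $N$. For $L\in\mathcal{L}_n$ and $A\subseteq\{1,\dots,n\}$, $ps_L(A)$ is the word obtained from $L$ by deleting, for every $i\in\{1,\dots,n\}\setminus A$, the $i$-th occurrence of $E$ and the $i$-th occurrence of $N$ (reading from left to right). For $P\in\mathcal{L}_2$, $P\text{-mch}(L)$ is the number of $j\in\{1,\dots,n-1\}$ with $ps_L(\{j,j+1\})=P$. Identities are between formal power series in $t$ with coefficients polynomial in $x_2,x_4$ (quotients taken in the fraction field); $\sqrt{1-4t}$ denotes the formal power series square root with constant term $1$. *)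

(* Defs.v *)
From HB Require Import structures.
From mathcomp Require Import all_boot all_order all_algebra.
From mathcomp Require Import boolp.
From mathcomp Require Import mpoly.

Set Implicit Arguments.
Unset Strict Implicit.
Unset Printing Implicit Defensive.

Import GRing.Theory.

Local Open Scope ring_scope.

(** * Lattice paths *)

Variant step := East | North.

Definition bool_of_step (s : step) : bool := if s is East then true else false.
Definition step_of_bool (b : bool) : step := if b then East else North.

Lemma bool_of_stepK : cancel bool_of_step step_of_bool.
Proof. by case. Qed.

HB.instance Definition _ := Finite.copy step (can_type bool_of_stepK).

Definition paths (n : nat) : {set (n + n).-tuple step} :=
  [set L : (n + n).-tuple step |
    (count_mem East L == n) && (count_mem North L == n)].

(* [occ L k = i] when the letter of [L] at (0-based) position [k] is the i-th
   occurrence of that letter; occurrences are numbered from 1. *)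
Definition occ (L : seq step) (k : nat) : nat :=
  count_mem (nth East L k) (take k.+1 L).

(* On a word with n letters East and n letters North all occurrence numbers lie
   in {1, ..., n}, so keeping those in [A] deletes exactly the i-th East and the
   i-th North for each i in {1, ..., n} outside [A]. *)
Definition ps (L : seq step) (A : pred nat) : seq step :=
  mask [seq A (occ L k) | k <- iota 0 (size L)] L.

Definition mch (P : seq step) (n : nat) (L : seq step) : nat :=
  count (fun j => ps L (pred2 j j.+1) == P) (index_iota 1 n).

Definition P2 : seq step := [:: East; North; East; North].
Definition P4 : seq step := [:: East; North; North; East].

Example ps_ex : ps [:: East; East; North; East; North; North] (pred2 2 3)
  = [:: East; East; North; North].
Proof. by []. Qed.

(** * Formal power series *)

Record fps (R : Type) := Fps { fcoef : nat -> R }.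

Lemma fpsP (R : Type) (f g : fps R) : fcoef f =1 fcoef g -> f = g.
Proof. by case: f g => [f] [g] /= /funext ->. Qed.

HB.instance Definition _ (R : Type) := gen_eqMixin (fps R).
HB.instance Definition _ (R : Type) := gen_choiceMixin (fps R).

Section FpsZmod.
Variable R : zmodType.
Implicit Types f g h : fps R.

Definition fps_zero : fps R := Fps (fun _ => 0).
Definition fps_opp f : fps R := Fps (fun n => - fcoef f n).
Definition fps_add f g : fps R := Fps (fun n => fcoef f n + fcoef g n).

Fact fps_addA : associative fps_add.
Proof. by move=> f g h; apply: fpsP => n /=; rewrite addrA. Qed.
Fact fps_addC : commutative fps_add.
Proof. by move=> f g; apply: fpsP => n /=; rewrite addrC. Qed.
Fact fps_add0 : left_id fps_zero fps_add.
Proof. by move=> f; apply: fpsP => n /=; rewrite add0r. Qed.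
Fact fps_addN : left_inverse fps_zero fps_opp fps_add.
Proof. by move=> f; apply: fpsP => n /=; rewrite addNr. Qed.

HB.instance Definition _ :=
  GRing.isZmodule.Build (fps R) fps_addA fps_addC fps_add0 fps_addN.
End FpsZmod.

Section FpsRing.
Variable R : comNzRingType.
Implicit Types f g h : fps R.

Definition fpsC (c : R) : fps R := Fps (fun n => if n == 0%N then c else 0).
Definition fpsX : fps R := Fps (fun n => (n == 1%N)%:R).
Definition fps_mul f g : fps R :=
  Fps (fun n => \sum_(i < n.+1) fcoef f i * fcoef g (n - i)).

Let trunc f (n : nat) : {poly R} := \poly_(i < n.+1) fcoef f i.

Fact fps_mul_trunc f g n k : (k <= n)%N ->
  fcoef (fps_mul f g) k = (trunc f n * trunc g n)`_k.
Proof.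
move=> le_kn; rewrite coefM /=; apply: eq_bigr => i _.
have le_ik : (i <= k)%N by rewrite -ltnS.
rewrite !coef_poly !ltnS (leq_trans le_ik le_kn).
by rewrite (leq_trans (leq_subr _ _) le_kn).
Qed.

Fact fps_mulC : commutative fps_mul.
Proof.
by move=> f g; apply: fpsP => n; rewrite !(fps_mul_trunc _ _ (leqnn n)) mulrC.
Qed.

Fact fps_mulA : associative fps_mul.
Proof.
move=> f g h; apply: fpsP => n.
have lhs : fcoef (fps_mul f (fps_mul g h)) n =
           (trunc f n * (trunc g n * trunc h n))`_n.
  rewrite coefM /=; apply: eq_bigr => i _.
  have le_in : (i <= n)%N by rewrite -ltnS.
  by rewrite coef_poly ltnS le_in -(fps_mul_trunc _ _ (leq_subr i n)).
have rhs : fcoef (fps_mul (fps_mul f g) h) n =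
           (trunc f n * trunc g n * trunc h n)`_n.
  rewrite coefM /=; apply: eq_bigr => i _.
  have le_in : (i <= n)%N by rewrite -ltnS.
  by rewrite [(trunc h n)`__]coef_poly ltnS leq_subr -(fps_mul_trunc _ _ le_in).
by rewrite lhs rhs mulrA.
Qed.

Fact fps_mul1 : left_id (fpsC 1) fps_mul.
Proof.
move=> f; apply: fpsP => n /=.
rewrite big_ord_recl /= mul1r subn0 big1 ?addr0 // => i _.
by rewrite /= mul0r.
Qed.

Fact fps_mulDl : left_distributive fps_mul (@fps_add R).
Proof.
move=> f g h; apply: fpsP => n /=.
by rewrite -big_split; apply: eq_bigr => i _; rewrite mulrDl.
Qed.

Fact fps_one_neq0 : fpsC 1 != 0 :> fps R.
Proof.
apply/eqP => /(congr1 (fun f => fcoef f 0)) /= /eqP.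
by rewrite oner_eq0.
Qed.

HB.instance Definition _ := GRing.Zmodule_isComNzRing.Build (fps R)
  fps_mulA fps_mulC fps_mul1 fps_mulDl fps_one_neq0.

Definition fps_unit : {pred fps R} := fun f => `[< exists g, g * f = 1 >].
Definition fps_inv f : fps R :=
  if pselect (exists g, g * f = 1) is left fU then projT1 (cid fU) else f.

Fact fps_mulVx : {in fps_unit, left_inverse 1 fps_inv *%R}.
Proof.
move=> f /asboolP fU; rewrite /fps_inv; case: pselect => // fU'.
by case: (cid fU').
Qed.
Fact fps_unitPl f g : g * f = 1 -> fps_unit f.
Proof. by move=> gf; apply/asboolP; exists g. Qed.
Fact fps_invr_out : {in [predC fps_unit], fps_inv =1 id}.
Proof.
by move=> f /asboolP fNU; rewrite /fps_inv; case: pselect.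
Qed.

HB.instance Definition _ := GRing.ComNzRing_hasMulInverse.Build (fps R)
  fps_mulVx fps_unitPl fps_invr_out.
End FpsRing.

Section FpsIdomain.
Variable R : idomainType.
Implicit Types f g : fps R.

Fact fps_neq0_order f : f != 0 ->
  exists2 n, fcoef f n != 0 & forall i, (i < n)%N -> fcoef f i = 0.
Proof.
move=> f_neq0.
have exn : exists n, fcoef f n != 0.
  apply: contrapT => all0; move/eqP: f_neq0; apply; apply: fpsP => n /=.
  by apply/eqP; apply: contrapT => /negP fn; apply: all0; exists n.
case: (ex_minnP exn) => n fn minn; exists n => // i lt_in.
by apply/eqP; apply: contraLR lt_in => /minn; rewrite -leqNgt.
Qed.

Fact fps_mulf_eq0 : GRing.integral_domain_axiom (fps R).
Proof.
move=> f g fg0; apply/norP => -[/fps_neq0_order[m fm fm0]].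
move=> /fps_neq0_order[n gn gn0].
have := congr1 (fun h => fcoef h (m + n)) fg0; rewrite /=.
have lt_m : (m < (m + n).+1)%N by rewrite ltnS leq_addr.
rewrite (bigD1 (Ordinal lt_m)) //= addKn big1 ?addr0.
  by move/eqP; rewrite mulf_eq0 (negPf fm) (negPf gn).
move=> i neq_im; case: (ltngtP i m) => [/fm0 ->|lt_mi|eq_im].
- by rewrite mul0r.
- rewrite [X in _ * X]gn0 ?mulr0 //.
  have le_i : (i <= m + n)%N by rewrite -ltnS.
  by rewrite ltn_subLR // ltn_add2r.
- by case/eqP: neq_im; apply: val_inj.
Qed.

HB.instance Definition _ :=
  GRing.ComUnitRing_isIntegral.Build (fps R) fps_mulf_eq0.

(* The square root with constant term 1, with default value 0 when there is
   none. *)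
Definition fps_sqrt f : fps R :=
  if pselect (exists g, fcoef g 0 = 1 /\ g ^+ 2 = f) is left fS
  then projT1 (cid fS) else 0.

Lemma fps_sqrtE f g : 2 != 0 :> R ->
  fcoef g 0 = 1 -> g ^+ 2 = f -> fps_sqrt f = g.
Proof.
move=> two_neq0 g0 gf; rewrite /fps_sqrt; case: pselect => [fS|[]]; last by exists g.
case: (cid fS) => h [h0 hf] /=.
move/eqP: hf; rewrite -gf eqf_sqr => /orP[/eqP //|/eqP hNg].
move: h0; rewrite hNg /= g0 => /eqP.
by rewrite eq_sym -addr_eq0 -mulr2n (negPf two_neq0).
Qed.
End FpsIdomain.

(** * The generating function *)

Notation coefRing := {mpoly int[2]}.

Definition x2 : coefRing := 'X_ord0.
Definition x4 : coefRing := 'X_ord_max.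

Definition F24 : fps coefRing :=
  Fps (fun n => if n == 0%N then 1
                else \sum_(L in paths n) x2 ^+ mch P2 n L * x4 ^+ mch P4 n L).

(* Main.v *)
Require Import Defs.
From HB Require Import structures.
From mathcomp Require Import all_boot all_order all_algebra.
From mathcomp Require Import boolp.
From mathcomp Require Import mpoly.
From mathcomp Require Import ring zify.

Import GRing.Theory.
Local Open Scope ring_scope.

Set Implicit Arguments.
Unset Strict Implicit.

(** The pair {j, j+1} matches P2 (resp. P4) exactly when the path visits (j, j),
    arriving by a step North and leaving by a step East (resp. North). Reading a word letter by letter from height h > 0 (resp. -h)
    until it ends on the diagonal gives generating functions A_h (resp. B_h)
    with A_(h+1) = A_h + t A_(h+2), whose only solution is A_h = A_0 C^h for
    the Catalan series C = 1 + t C^2. With c = t C this leaves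
    A_0 = 1 + x2 c A_0 + x4 c B_0 and B_0 = 1 + c A_0 + c B_0, where B_0 is the
    series sought, and c = (1 - sqrt (1 - 4 t)) / 2. *)

(** * Subwords [ps] at points of the diagonal *)

Definition other (s : step) : step := if s is East then North else East.

Lemma otherK : involutive other.
Proof. by case. Qed.

(** Occurrence numbers look only to the left: a new last letter [z] changes no earlier number and
    itself gets [(count_mem z L).+1]. *)
Lemma ps_rcons (L : seq step) (z : step) (A : pred nat) :
  ps (rcons L z) A = ps L A ++ nseq (A (count_mem z L).+1) z.
Proof.
rewrite /ps size_rcons -addn1 iotaD map_cat -cats1 mask_cat; last first.
  by rewrite size_map size_iota.
congr (_ ++ _).
  congr (mask _ L); apply/eq_in_map => k; rewrite mem_iota add0n /= => kL.
  by rewrite /occ nth_cat kL takel_cat.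
rewrite /= add0n /occ nth_cat ltnn subnn /= take_oversize ?size_cat ?addn1 //.
by rewrite count_cat /= eqxx addn0 addn1; case: (A _).
Qed.

Lemma count_ps (z : step) (L : seq step) (A : pred nat) :
  count_mem z (ps L A) = count A (iota 1 (count_mem z L)).
Proof.
elim/last_ind: L => [//|L y IH].
rewrite ps_rcons count_cat IH -cats1 count_cat /= addn0.
case: (y =P z) => [->|/eqP/negPf yz] /=.
  by rewrite iotaD count_cat /= addn0 add1n count_nseq /= eqxx mul1n.
by rewrite addn0 count_nseq /= yz mul0n addn0.
Qed.

Lemma ps_prefix (L1 L2 : seq step) (A : pred nat) :
  exists L, ps (L1 ++ L2) A = ps L1 A ++ L.
Proof.
elim/last_ind: L2 => [|L2 z [L IH]]; first by exists [::]; rewrite !cats0.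
by rewrite -rcons_cat ps_rcons IH -catA; eexists.
Qed.

Lemma count_pred2_iota (j m : nat) : (0 < j)%N ->
  count (pred2 j j.+1) (iota 1 m) = ((j <= m) + (j < m))%N.
Proof.
move=> j_gt0; elim: m => [|m IH]; first by rewrite leqNgt j_gt0.
rewrite -(addn1 m) iotaD count_cat IH /= addn0 add1n; lia.
Qed.

Lemma size_count_step (z : step) (L : seq step) :
  size L = (count_mem z L + count_mem (other z) L)%N.
Proof.
by case: z; elim: L => //= z L ->; case: z => /=; rewrite ?addnS ?addSn.
Qed.

Lemma count_other0 (z : step) (L : seq step) :
  count_mem (other z) L = 0%N -> L = nseq (count_mem z L) z.
Proof.
by elim: L => //= y L IH; case: y z IH => -[] //= IH /IH {1}->.
Qed.

(* A position on the diagonal at (j, j) separates the j-th letters from the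
   (j+1)-st ones. *)
Lemma ps_diagonal (L1 L2 : seq step) (x y : step) (j : nat) :
  count_mem x L1 = j -> count_mem (other x) L1 = j.+1 ->
  (0 < count_mem (other y) L2)%N ->
  ps (rcons L1 x ++ y :: L2) (pred2 j.+1 j.+2) = [:: other x; x; y; other y].
Proof.
move=> cx cox cy.
have yE : count_mem y (rcons L1 x) = j.+1.
  rewrite -cats1 count_cat /= addn0.
  by case: x y cx cox {cy} => -[] /=; lia.
rewrite -cat_rcons; have [R] := ps_prefix (rcons (rcons L1 x) y) L2 (pred2 j.+1 j.+2).
rewrite !ps_rcons cx yE /= !eqxx orbT /=.
have -> : ps L1 (pred2 j.+1 j.+2) = [:: other x].
  have c0 : count_mem x (ps L1 (pred2 j.+1 j.+2)) = 0%N.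
    by rewrite count_ps cx count_pred2_iota // ltnn; lia.
  have c1 : count_mem (other x) (ps L1 (pred2 j.+1 j.+2)) = 1%N.
    by rewrite count_ps cox count_pred2_iota // leqnn ltnn.
  by rewrite -(otherK x) in c0; rewrite (count_other0 c0) c1.
move=> E; rewrite E /=; congr [:: _, _, _ & _].
(* Both letters occur twice in the whole subword, [L2] supplying the missing [other y]. The three
   letters found so far contain [y] twice, so [R] is a single [other y]. *)
have cR z : (count_mem z R = (z == other y))%N.
  have := count_ps z (rcons (rcons L1 x) y ++ L2) (pred2 j.+1 j.+2).
  rewrite E count_pred2_iota // count_cat /= -!cats1 !count_cat /=.
  by case: x y z cx cox cy {yE E} => -[] [] /=; lia.
have := count_other0 (z := other y) (L := R); rewrite !cR eqxx => -> //.
by case: y {cy yE E cR}.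
Qed.

(* The left-hand side compares with P2 when y is East, with P4 when y is North. *)
Lemma ps_matchE (n j : nat) (L : seq step) (y : step) :
  count_mem East L = n -> count_mem North L = n -> (0 < j < n)%N ->
  (ps L (pred2 j j.+1) == [:: East; North; y; other y]) =
  [&& count_mem East (take j.*2 L) == count_mem North (take j.*2 L),
      last East (take j.*2 L) == North & nth East L j.*2 == y].
Proof.
move=> cE cN /andP[j0 jn].
have sL : size L = n.*2 by rewrite (size_count_step East) /= cE cN addnn.
have sT : size (take j.*2 L) = j.*2 by rewrite size_takel // sL leq_double ltnW.
have [R] := ps_prefix (take j.*2 L) (drop j.*2 L) (pred2 j j.+1).
rewrite cat_take_drop => psE.
have cT z := count_ps z (take j.*2 L) (pred2 j j.+1).
have := sT; rewrite (size_count_step East) /= => sT'.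
have half a b : (a + b = j.*2 -> a < b -> (a < j < b))%N by lia.
(* Off the diagonal, the prefix of length 2j has more than j copies of one letter and fewer than j
   of the other, so the subword begins with two equal letters. *)
case: (ltngtP (count_mem East (take j.*2 L)) (count_mem North (take j.*2 L))) => /= c.
- have /andP[lt1 lt2] := half _ _ sT' c.
  rewrite psE (@count_other0 North (ps _ _)) cT count_pred2_iota //=.
    by rewrite lt2 (ltnW lt2).
  by rewrite leqNgt lt1 ltnNge (ltnW lt1).
- have /andP[lt1 lt2] := half _ _ (etrans (addnC _ _) sT') c.
  rewrite psE (@count_other0 East (ps _ _)) cT count_pred2_iota //=.
    by rewrite lt2 (ltnW lt2).
  by rewrite leqNgt lt1 ltnNge (ltnW lt1).
have Tj z : count_mem z (take j.*2 L) = j.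
  by move: sT' c; case: z; move: (count _ _) (count _ _) => a b; lia.
case: j j0 jn {half psE cT R sT' c} sT Tj => // j _ jn sT Tj.
have LE := cat_take_drop j.+1.*2 L.
have dE := drop_nth East (_ : j.+1.*2 < size L)%N.
rewrite sL ltn_double in dE; rewrite {}dE // in LE.
case/lastP: (take _ _) sT Tj LE => // L1 x sT Tj LE.
rewrite last_rcons -{1}LE ps_diagonal.
- by case: x y (nth _ _ _) {sT Tj LE} => -[] [].
- by have := Tj x; rewrite -cats1 count_cat /= eqxx; lia.
- by have := Tj (other x); rewrite -cats1 count_cat /=; case: x {sT Tj LE} => /=; lia.
(* The diagonal point lies before (n, n), so both letters still occur after it. *)
have := congr1 (count_mem (other (nth East L j.+1.*2))) LE.
rewrite count_cat Tj /=.
by case: (nth _ _ _) => /=; rewrite ?cE ?cN; lia.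
Qed.

(** * Matches as turns at height 0 *)

Definition rise (z : step) : int := if z is East then 1 else -1.

Definition height (L : seq step) : int :=
  (count_mem East L)%:Z - (count_mem North L)%:Z.

Lemma height_cons (z : step) (L : seq step) :
  height (z :: L) = rise z + height L.
Proof. by rewrite /height /=; case: z => /=; lia. Qed.

(* Number of steps y of L leaving the diagonal just after a step North, when L
   starts at height h, preceded by a step p. *)
Fixpoint turns (y : step) (h : int) (p : step) (L : seq step) : nat :=
  if L is z :: L' then
    ([&& h == 0, p == North & z == y] + turns y (h + rise z)%R z L')%N
  else 0%N.

Lemma turns_rcons (y : step) (h : int) (p : step) (L : seq step) (z : step) :
  turns y h p (rcons L z) =
  (turns y h p L + [&& (h + height L == 0)%R, last p L == North & z == y])%N.
Proof.
elim: L h p => [|x L IH] h p /=; first by rewrite /height /= !addr0 addn0.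
by rewrite IH height_cons !addrA addnA.
Qed.

Lemma turnsE (y : step) (L : seq step) :
  turns y 0 East L =
  (\sum_(0 <= k < size L) [&& height (take k L) == 0,
     last East (take k L) == North & nth East L k == y])%N.
Proof.
elim/last_ind: L => [|L z IH]; first by rewrite big_nil.
rewrite turns_rcons IH size_rcons big_nat_recr //= add0r; congr addn.
  apply: eq_big_nat => k /andP[_ kL].
  by rewrite -cats1 takel_cat 1?ltnW // nth_cat kL.
by rewrite -cats1 take_size_cat // nth_cat ltnn subnn.
Qed.

Lemma sum_nat_double (F : nat -> nat) (n : nat) :
  (\sum_(0 <= k < n.*2) F k = \sum_(0 <= j < n) (F j.*2 + F j.*2.+1))%N.
Proof.
elim: n => [|n IH]; first by rewrite !big_nil.
by rewrite doubleS !big_nat_recr //= IH addnA.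
Qed.

(** The height vanishes only at even positions, where [ps_matchE] identifies the summands. *)
Lemma mch_turns (y : step) (n : nat) (L : seq step) :
  count_mem East L = n -> count_mem North L = n ->
  mch [:: East; North; y; other y] n L = turns y 0 East L.
Proof.
move=> cE cN.
have sL : size L = n.*2 by rewrite (size_count_step East) /= cE cN addnn.
rewrite turnsE sL sum_nat_double.
have -> : mch [:: East; North; y; other y] n L =
    (\sum_(1 <= j < n) (ps L (pred2 j j.+1) == [:: East; North; y; other y]))%N.
  by rewrite /mch -sum1_count big_mkcond.
have odd0 k : (k < n)%N -> (height (take k.*2.+1 L) == 0) = false.
  move=> kn; have := size_count_step East (take k.*2.+1 L).
  rewrite size_takel ?sL ?ltn_double // /height /=.
  by move: (count _ _) (count _ _) => a b ab; apply/eqP; lia.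
case: n cE cN sL odd0 => [|n] cE cN sL odd0; first by rewrite !big_geq.
(* Position 0 counts nothing, its preceding letter being [East] by default. *)
rewrite [RHS]big_ltn // odd0 //= take0 /= add0n.
apply: eq_big_nat => j jn; rewrite (ps_matchE _ cE cN jn).
rewrite odd0 ?addn0; last by case/andP: jn.
by rewrite /height subr_eq0.
Qed.

(** * Weighted words by starting height *)

Section Words.
Variables (R : comNzRingType) (a b : R).

Definition word_weight (h : int) (p : step) (L : seq step) : R :=
  a ^+ turns East h p L * b ^+ turns North h p L.

(** The preceding step [p] is a parameter because a first letter read on the diagonal is weighted
    only after [North]. *)
Definition word_sum (m : nat) (h : int) (p : step) : R :=
  \sum_(L : m.-tuple step | h + height L == 0) word_weight h p L.

Lemma big_step (F : step -> R) : \sum_(z : step) F z = F East + F North.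
Proof.
rewrite (bigD1 East) //= (bigD1 North) //= big1 ?addr0 //.
by case.
Qed.

Lemma word_sum0 (h : int) (p : step) : word_sum 0 h p = (h == 0)%:R.
Proof.
rewrite /word_sum (eq_bigl (fun=> h == 0)); last first.
  by move=> L; rewrite tuple0 /height /= !addr0.
rewrite (eq_bigr (fun=> 1)); last first.
  by move=> L _; rewrite tuple0 /word_weight /= mulr1.
case: (h == 0); last by rewrite big_pred0.
by rewrite sumr_const card_tuple expn0.
Qed.

Lemma word_sumS (m : nat) (h : int) (p : step) :
  let turning := (h == 0) && (p == North) in
  word_sum m.+1 h p =
  (if turning then a else 1) * word_sum m (h + 1) East +
  (if turning then b else 1) * word_sum m (h - 1) North.
Proof.
rewrite /word_sum.
rewrite (reindex (fun u : step * m.-tuple step => [tuple of u.1 :: u.2])) /=; last first.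
  exists (fun L : m.+1.-tuple step => (thead L, [tuple of behead L])).
    by move=> [z L] _ /=; congr pair; apply: val_inj.
  by move=> L _; rewrite [RHS]tuple_eta; apply: val_inj.
rewrite (eq_bigl (fun u : step * m.-tuple step =>
    true && (h + rise u.1 + height u.2 == 0))); last first.
  by move=> u; rewrite height_cons addrA.
rewrite -(pair_big_dep xpredT (fun z (L : m.-tuple step) => h + rise z + height L == 0)
   (fun z (L : m.-tuple step) => word_weight h p (z :: L))) /= big_step.
congr (_ + _); rewrite big_distrr /=; apply: eq_bigr => L _;
  rewrite /word_weight /= !exprD; case: (h == 0); case: p => /=;
  by rewrite ?expr0 ?expr1; ring.
Qed.

Lemma word_sum_prev (m : nat) (h : int) (p q : step) :
  h != 0 -> word_sum m h p = word_sum m h q.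
Proof.
move=> /negPf h0; case: m => [|m]; first by rewrite !word_sum0.
by rewrite !word_sumS h0.
Qed.

Lemma word_sum_far (m : nat) (h : int) (p : step) :
  (m < `|h|)%N -> word_sum m h p = 0.
Proof.
elim: m h p => [|m IH] h p mh.
  by rewrite word_sum0; case: eqP mh => // ->.
rewrite word_sumS !IH ?mulr0 ?addr0 //; lia.
Qed.

(** This is A_h. Returning from height h takes h + 2n letters, so t marks the n surplus pairs. The
    letter [North], which matters only for h = 0, is the one that reaches the diagonal from
    below. *)
Definition below (h : nat) : fps R :=
  Fps (fun n => word_sum (h + n.*2) h%:Z North).

(** This is B_h. At h = 0 the letter [East] also suits the start of a path, where no match is
    counted. *)
Definition above (h : nat) : fps R :=
  Fps (fun n => word_sum (h + n.*2) (- h%:Z) East).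

Lemma fcoefD (f g : fps R) (n : nat) : fcoef (f + g) n = fcoef f n + fcoef g n.
Proof. by []. Qed.

Lemma fcoef_XM (f : fps R) (n : nat) :
  fcoef (fpsX R * f) n = if n is m.+1 then fcoef f m else 0.
Proof.
rewrite [LHS]/=; case: n => [|n]; first by rewrite big_ord1 mul0r.
rewrite big_ord_recl big_ord_recl /= mul0r add0r mul1r subSS subn0.
by rewrite big1 ?addr0 // => i _; rewrite /= mul0r.
Qed.

Lemma fcoef_CM (c : R) (f : fps R) (n : nat) :
  fcoef (fpsC c * f) n = c * fcoef f n.
Proof.
rewrite [LHS]/= big_ord_recl /= subn0 big1 ?addr0 // => i _.
by rewrite mul0r.
Qed.

(** A first step [North] leads to height h with the same surplus, a first step [East] to height h +
    2 with one pair less. *)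
Lemma below_rec (h : nat) : below h.+1 = below h + fpsX R * below h.+2.
Proof.
apply: fpsP => n; rewrite fcoefD fcoef_XM /=.
rewrite addSn word_sumS /= !mul1r addrC; congr (_ + _).
  by congr (word_sum _ _ _); lia.
case: n => [|n]; last by rewrite (word_sum_prev _ _ North) //; congr (word_sum _ _ _); lia.
(* For n = 0 the h letters left are too few to return from h + 2. *)
by apply: word_sum_far; lia.
Qed.

Lemma above_rec (h : nat) : above h.+1 = above h + fpsX R * above h.+2.
Proof.
apply: fpsP => n; rewrite fcoefD fcoef_XM /=.
rewrite addSn word_sumS andbF !mul1r; congr (_ + _).
  by congr (word_sum _ _ _); lia.
case: n => [|n]; last by rewrite (word_sum_prev _ _ East) //; congr (word_sum _ _ _); lia.
by apply: word_sum_far; lia.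
Qed.

Lemma below0 :
  below 0 = 1 + fpsC a * (fpsX R * below 1) + fpsC b * (fpsX R * above 1).
Proof.
apply: fpsP => n.
rewrite !fcoefD !fcoef_CM !fcoef_XM.
case: n => [|n]; first by rewrite /= word_sum0 !mulr0 !addr0.
rewrite [fcoef 1 _]/= add0r -[LHS]/(word_sum n.*2.+2 0 North) word_sumS.
rewrite eqxx add0r sub0r.
by congr (_ + _); congr (_ * _); apply: word_sum_prev.
Qed.

Lemma above0 : above 0 = 1 + fpsX R * below 1 + fpsX R * above 1.
Proof.
apply: fpsP => n.
rewrite !fcoefD !fcoef_XM.
case: n => [|n]; first by rewrite /= word_sum0 !addr0.
rewrite [fcoef 1 _]/= add0r -[LHS]/(word_sum n.*2.+2 0 East) word_sumS.
rewrite andbF add0r sub0r !mul1r.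
by congr (_ + _); apply: word_sum_prev.
Qed.
End Words.

(** * The Catalan series and its recurrence *)

Section Catalan.
Variable R : comNzRingType.

Lemma fcoef_mul_eq (f f' g g' : fps R) (n : nat) :
  (forall i, (i <= n)%N -> fcoef f i = fcoef f' i) ->
  (forall i, (i <= n)%N -> fcoef g i = fcoef g' i) ->
  fcoef (f * g) n = fcoef (f' * g') n.
Proof.
move=> ff' gg'; apply: eq_bigr => i _.
by rewrite ff' ?gg' ?leq_subr // -ltnS.
Qed.

(** The iterates of f -> 1 + t f^2 from 0 stabilise coefficientwise: coefficient n is final from
    iterate n + 1 on. *)
Lemma catalan_fps_exists : exists C : fps R, C = 1 + fpsX R * (C * C).
Proof.
pose step f : fps R := 1 + fpsX R * (f * f); pose u k := iter k step 0.
have stable k n : (n < k)%N -> fcoef (u k.+1) n = fcoef (u k) n.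
  elim: k n => // k IH n nk.
  rewrite [u k.+2]/(step (u k.+1)) [u k.+1 in RHS]/(step (u k)) !fcoefD !fcoef_XM.
  case: n nk => // n nk; congr (_ + _).
  by apply: fcoef_mul_eq => i i_n; apply: IH; apply: leq_ltn_trans i_n _.
have stableD k m n : (n < k)%N -> fcoef (u (k + m)%N) n = fcoef (u k) n.
  move=> nk; elim: m => [|m IH]; first by rewrite addn0.
  by rewrite addnS stable ?IH // ltn_addr.
exists (Fps (fun n => fcoef (u n.+1) n)); apply: fpsP => n.
rewrite -[LHS]/(fcoef (step (u n)) n) !fcoefD !fcoef_XM.
case: n => // n; congr (_ + _).
by apply: fcoef_mul_eq => i i_n; have := stableD i.+1 (n - i)%N i (ltnSn i); rewrite addSn subnKC.
Qed.

(** Coefficient n of D(h+1) - D(h) is coefficient n - 1 of D(h+2), so induction on n, and then on h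
    starting from D(0) = 0, settles every coefficient. *)
Lemma fps_rec_unique (D : nat -> fps R) :
  D 0%N = 0 -> (forall h, D h.+1 = D h + fpsX R * D h.+2) ->
  forall h, D h = 0.
Proof.
move=> D0 Drec h; apply: fpsP => n; elim: n h => [|n IHn] h.
  by elim: h => [|h IHh]; rewrite ?D0 // Drec fcoefD fcoef_XM IHh addr0.
by elim: h => [|h IHh]; rewrite ?D0 // Drec fcoefD fcoef_XM IHh IHn addr0.
Qed.

(** The powers C^h solve the same recurrence, which is C = 1 + t C^2 times C^h; the difference falls
    under [fps_rec_unique]. *)
Lemma fps_rec_geometric (C : fps R) (D : nat -> fps R) :
  C = 1 + fpsX R * (C * C) -> (forall h, D h.+1 = D h + fpsX R * D h.+2) ->
  forall h, D h = D 0%N * C ^+ h.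
Proof.
move=> CE Drec h; apply/eqP; rewrite -subr_eq0; apply/eqP.
apply: (fps_rec_unique (D := fun h => D h - D 0%N * C ^+ h)) => [|{}h].
  by rewrite mulr1 subrr.
have CS : C ^+ h.+1 = C ^+ h + fpsX R * C ^+ h.+2.
  by rewrite exprS {1}CE !exprS; ring.
by rewrite Drec CS; ring.
Qed.

End Catalan.

(** * From lattice paths to the closed form *)

Lemma paths_height (n : nat) (L : (n + n).-tuple step) :
  (L \in paths n) = (0 + height L == 0).
Proof.
rewrite inE add0r /height subr_eq0 eqz_nat.
have := size_count_step East L; rewrite size_tuple /=.
by move: (count _ _) (count _ _) => a b ab; apply/andP/eqP => [[]|]; lia.
Qed.

Lemma F24_above : F24 = above x2 x4 0.
Proof.
apply: fpsP => n; rewrite [RHS]/= add0n -addnn oppr0 /word_sum.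
(* At n = 0 the only path is empty and has weight 1, which absorbs the case distinction in [F24]. *)
transitivity (\sum_(L in paths n) x2 ^+ mch P2 n L * x4 ^+ mch P4 n L).
  case: n => //=; rewrite (eq_bigl xpredT) => [|L]; last first.
    by rewrite paths_height (tuple0 L).
  by rewrite (eq_bigr (fun=> 1)) ?sumr_const ?card_tuple ?expn0 // => L _; rewrite mulr1.
apply: eq_big => [L|L]; first exact: paths_height.
by rewrite inE => /andP[/eqP cE /eqP cN]; rewrite /word_weight -!(mch_turns _ cE cN).
Qed.

Lemma fcoef0M (R : comNzRingType) (f g : fps R) :
  fcoef (f * g) 0 = fcoef f 0 * fcoef g 0.
Proof. by rewrite /= big_ord1. Qed.

Lemma two_block_system (S : comNzRingType) (A B c x y : S) :
  A = 1 + x * c * A + y * c * B -> B = 1 + c * A + c * B ->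
  let s := 1 - 2 * c in let t := c - c ^+ 2 in
  (x - 2) * (- 1 + s) + 2 * (x - 1) * t =
  B * (y * (- 1 + s) + (2 + x * (- 1 + s) + 3 * y - y * s) * t).
Proof.
move=> AE BE s t; apply/eqP; rewrite eq_sym -subr_eq0.
(* The multipliers 1 - xc and c cancel [A]; in front stands the common factor 2c of numerator and
   denominator. *)
rewrite [X in X == 0](_ : _ = 2 * c *
  ((1 - x * c) * (B - (1 + c * A + c * B)) +
   c * (A - (1 + x * c * A + y * c * B)))); last by rewrite /s /t; ring.
by rewrite -AE -BE !subrr !mulr0 addr0 mulr0.
Qed.

(** For a power series c with constant term 0 the last factor has constant term 1, so over a domain
    the denominator is nonzero once 2 and c are. *)
Lemma two_block_denominator (S : comNzRingType) (c x y : S) :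
  let s := 1 - 2 * c in let t := c - c ^+ 2 in
  y * (- 1 + s) + (2 + x * (- 1 + s) + 3 * y - y * s) * t =
  2 * c * (1 + c * (x * c - x - y * c - 1)).
Proof. by rewrite /=; ring. Qed.

(** With c = t C this yields 1 - 4t = (1 - 2c)^2, hence the square root. *)
Lemma catalan_quadratic (S : comNzRingType) (t C : S) :
  C = 1 + t * (C * C) -> t = t * C - (t * C) ^+ 2.
Proof.
move=> CE; rewrite (_ : _ - _ = t * (C - t * (C * C))); last by ring.
by rewrite {1}CE addrK mulr1.
Qed.

Lemma above_closed_form (R : idomainType) (a b : R) : 2 != 0 :> R ->
  let t := fpsX R in let x := fpsC a in let y := fpsC b in
  let s := fps_sqrt (1 - 4 * t) in
  let D := y * (- 1 + s) + (2 + x * (- 1 + s) + 3 * y - y * s) * t in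
  D != 0 /\ (x - 2) * (- 1 + s) + 2 * (x - 1) * t = above a b 0 * D.
Proof.
move=> two_neq0 t x y s D; have [C CE] := catalan_fps_exists R.
have c0 : fcoef (t * C) 0 = 0 by rewrite fcoef_XM.
have tE := catalan_quadratic CE; rewrite -/t in tE.
have AE : below a b 0 = 1 + x * (t * C) * below a b 0 + y * (t * C) * above a b 0.
  rewrite {1}below0 (fps_rec_geometric CE (below_rec a b)).
  by rewrite (fps_rec_geometric CE (above_rec a b)) -/t -/x -/y; ring.
have BE : above a b 0 = 1 + t * C * below a b 0 + t * C * above a b 0.
  rewrite {1}above0 (fps_rec_geometric CE (below_rec a b)).
  by rewrite (fps_rec_geometric CE (above_rec a b)) -/t; ring.
(* From here on [c] is known only by its constant term 0, t = c - c^2 and the two linear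
   equations. *)
move: (t * C) c0 tE AE BE => c c0 tE AE BE.
have sE : s = 1 - 2 * c.
  apply: fps_sqrtE => //; last by rewrite tE; ring.
  by rewrite fcoefD -[fcoef (- _) 0]/(- fcoef (2 * c) 0) fcoef0M c0 mulr0 subr0.
have cN0 : c != 0.
  apply: contra_eq_neq tE => ->; rewrite expr0n subr0; apply/eqP.
  by move/(congr1 (fun f => fcoef f 1))/eqP; rewrite /= oner_eq0.
have U0 (f : fps R) : 1 + c * f != 0.
  apply/eqP => /(congr1 (fun f => fcoef f 0))/eqP.
  by rewrite fcoefD fcoef0M c0 mul0r addr0 oner_eq0.
have twoN0 : 2 != 0 :> fps R.
  by apply: contra_neq two_neq0 => /(congr1 (fun f => fcoef f 0)).
rewrite /D sE tE; split; last exact: two_block_system AE BE.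
by rewrite two_block_denominator; apply: mulf_neq0 (U0 _); apply: mulf_neq0.
Qed.

Theorem mainTheorem11 :
  let t : fps coefRing := fpsX coefRing in
  let X2 : fps coefRing := fpsC x2 in
  let X4 : fps coefRing := fpsC x4 in
  let s : fps coefRing := fps_sqrt (1 - 4 * t) in
  tofrac F24 =
    tofrac ((X2 - 2) * (- 1 + s) + 2 * (X2 - 1) * t) /
    tofrac (X4 * (- 1 + s) + (2 + X2 * (- 1 + s) + 3 * X4 - X4 * s) * t)
  :> {fraction (fps coefRing)}.
Proof.
move=> t X2 X4 s.
have two_neq0 : 2 != 0 :> coefRing.
  by rewrite -(rmorph_nat (@mpolyC 2 int)) mpolyC_eq0.
have [DN0 ->] := above_closed_form x2 x4 two_neq0.
by rewrite F24_above tofracM mulfK // tofrac_eq0.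
Qed.
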